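(* Let $\mathcal{E}$ be a Euclidean vector space, $C$ a nonempty closed subset of $\mathcal{E}$, $S$ a nonempty proper subset of $C$, and $\varphi:\mathcal{E}\to\mathbb{R}$ a function that is continuous on $C$. Let $s$ be a positive integer and, for every $i\in\{1,\dots,s\}$, let $A_i$ be a $(\varphi,C,S)$-sufficient-descent map. Then every map that associates a nonempty subset of $\bigcup_{i=1}^sA_i(x)$ with every $x\in C$ is a $(\varphi,C,S)$-sufficient-descent map.
   Context: $B[x,\varepsilon]$ denotes the closed ball of center $x$ and radius $\varepsilon$ in $\mathcal{E}$. A $(\varphi,C,S)$-sufficient-descent map is a set-valued map $A$ from $C$ to $C$ such that: (1) $A(x)\neq\emptyset$ for all $x\in C$; (2) for every $\underline{x}\in C\setminus S$, there exist $\varepsilon(\underline{x}),\delta(\underline{x})\in(0,\infty)$ such that, for all $x\in B[\underline{x},\varepsilon(\underline{x})]\cap C$, $\varphi(x)-\sup\varphi(A(x))\ge\delta(\underline{x})$. *)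

(* Defs.v *)
From HB Require Import structures.
From mathcomp Require Import all_boot all_order all_algebra.
From mathcomp Require Import all_classical all_reals all_analysis.

Set Implicit Arguments.
Unset Strict Implicit.
Unset Printing Implicit Defensive.

Import Order.TTheory GRing.Theory Num.Theory.
Import numFieldNormedType.Exports.

Local Open Scope classical_set_scope.
Local Open Scope ring_scope.

(* The norm, and hence the topology, of a Euclidean space is the one induced by
   its inner product; finite dimension comes from [Vector]. *)
HB.mixin Record NormedModule_isEuclidean (R : realType) E
    & NormedModule R E := {
  inner : {dot E for (@idfun R)};
  normr_inner : forall x : E, `|x| = Num.sqrt (inner x x)
}.

#[short(type="euclideanType")]
HB.structure Definition Euclidean (R : realType) :=
  {E of NormedModule R E & Vector R E & NormedModule_isEuclidean R E}.

Section SufficientDescent.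
Context {R : realType} {E : euclideanType R}.

(* A set-valued map from [C] to [C] is encoded as [A : E -> set E] with
   [A x `<=` C] for [x] in [C]; its values outside [C] are irrelevant. *)
Definition setvalued_map (C : set E) (A : E -> set E) : Prop :=
  forall x, C x -> A x `<=` C.

(* The supremum of [phi] over [A x] is taken in the extended reals. If it is
   [+oo], the left-hand side of the inequality is [-oo], which is not at least
   [delta]. *)
Definition sufficient_descent_map (phi : E -> R) (C S : set E)
    (A : E -> set E) : Prop :=
  [/\ setvalued_map C A,
      forall x, C x -> A x !=set0
    & forall x0, (C `\` S) x0 ->
        exists eps delta : R, [/\ 0 < eps, 0 < delta
          & forall x, (closed_ball_ Num.norm x0 eps `&` C) x ->
              (delta%:E <= (phi x)%:E
                           - ereal_sup [set (phi y)%:E | y in A x])%E]].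

End SufficientDescent.

(* Main.v *)
Require Import Defs.
From HB Require Import structures.
From mathcomp Require Import all_boot all_order all_algebra.
From mathcomp Require Import all_classical all_reals all_analysis.

Set Implicit Arguments.
Unset Strict Implicit.
Unset Printing Implicit Defensive.

Import Order.TTheory GRing.Theory Num.Theory.
Import numFieldNormedType.Exports.

Local Open Scope classical_set_scope.
Local Open Scope ring_scope.

(** Fix [x0] in [C] outside [S]. There are finitely many maps [A i], so the least of their radii and
    the least of their decrements at [x0] are positive and serve all of them at once. A point of
    [B x] lies in some [A i x], hence inherits that common decrease. [le_subr_ereal_supP] makes this
    pointwise argument possible by removing the supremum; [ex_pos_lower_bound] supplies the two
    minima. *)

Lemma le_subr_ereal_supP (R : realType) (T : Type) (f : T -> R) (D : set T)
    (a d : R) :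
  (d%:E <= a%:E - ereal_sup [set (f y)%:E | y in D])%E <->
  (forall y, D y -> f y + d <= a).
Proof.
split=> [le_d y Dy|le_fd].
  have : ((f y)%:E <= ereal_sup [set (f y)%:E | y in D])%E.
    by apply: ereal_sup_ubound; exists y.
  move: le_d; case: (ereal_sup _) => [r| |] //=.
  by rewrite -EFinB !lee_fin lerBrDl => le_a le_f; apply: le_trans le_a; rewrite lerD2r.
(* This real bound excludes a supremum of [+oo]. The value [-oo], taken when [D] is empty, makes the
   difference [+oo]. *)
have : (ereal_sup [set (f y)%:E | y in D] <= (a - d)%:E)%E.
  apply: ge_ereal_sup => _ [y Dy <-].
  by rewrite lee_fin lerBrDr le_fd.
case: (ereal_sup _) => [r| |] //=; last by rewrite leey.
by rewrite -EFinB !lee_fin lerBrDr lerBrDl.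
Qed.

Lemma ex_pos_lower_bound (R : realDomainType) (I : finType) (f : I -> R) :
  (forall i, 0 < f i) -> exists2 m, 0 < m & forall i, m <= f i.
Proof.
(* The default [1] of the iterated minimum is positive, so the minimum stays positive, even over an
   empty [I]. *)
move=> f_gt0; exists (\big[Num.min/1]_i f i).
  by apply: lt_bigmin => // i _; exact: f_gt0.
by move=> i; exact: bigmin_le_cond.
Qed.

Theorem proposition3p3 (R : realType) (E : euclideanType R) (C S : set E)
    (phi : E -> R) (s : nat) (A : 'I_s -> E -> set E) (B : E -> set E)
    (C_neq0 : C !=set0) (C_closed : closed C)
    (S_neq0 : S !=set0) (S_proper : S `<` C)
    (phi_cont : {within C, continuous phi})
    (s_gt0 : (0 < s)%N)
    (A_descent : forall i, sufficient_descent_map phi C S (A i))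
    (B_sub : forall x, C x -> B x !=set0 /\ B x `<=` \bigcup_i A i x) :
  sufficient_descent_map phi C S B.
Proof.
split=> [x Cx y By|x Cx|x0 CSx0].
- have [i _ Aiy] := (B_sub x Cx).2 y By.
  by have [AiC _ _] := A_descent i; exact: AiC x Cx y Aiy.
- exact: (B_sub x Cx).1.
(* Radius and decrement are chosen together, as a pair depending on [i], so that minima over [i] can
   be taken. *)
have /choice[ed edP] : forall i, exists ed : R * R, [/\ 0 < ed.1, 0 < ed.2
    & forall x, (closed_ball_ Num.norm x0 ed.1 `&` C) x ->
        forall y, A i x y -> phi y + ed.2 <= phi x].
  move=> i; have [_ _ /(_ _ CSx0)[e [d [e0 d0 le_d]]]] := A_descent i.
  by exists (e, d); split=> // x /le_d/le_subr_ereal_supP.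
have [|eps eps_gt0 le_eps] := @ex_pos_lower_bound _ _ (fun i => (ed i).1).
  by move=> i; have [] := edP i.
have [|delta delta_gt0 le_delta] := @ex_pos_lower_bound _ _ (fun i => (ed i).2).
  by move=> i; have [] := edP i.
exists eps, delta; split=> // x [x0x Cx]; apply/le_subr_ereal_supP => y By.
have [i _ Aiy] := (B_sub x Cx).2 y By.
have [_ _ descent] := edP i.
(* [delta] is at most the decrement of [A i], and the ball of radius [eps] lies in the ball of
   [A i]. *)
apply: le_trans (descent x _ y Aiy); first by rewrite lerD2l.
by split=> //; exact: le_trans x0x (le_eps i).
Qed.
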